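(* The critical cardinalities of $\mathsf{U}_{[1,\aleph_0)}(\mathcal{B}_\Gamma,\mathcal{B}_{\mathrm{T}})$, $\mathsf{U}_{[1,\aleph_0)}(\Gamma,\mathrm{T})$, and $\mathsf{U}_{[1,\aleph_0)}(C_\Gamma,C_{\mathrm{T}})$ are all equal to $\mathfrak{b}$; that is, $$\mathsf{non}(\mathsf{U}_{[1,\aleph_0)}(\mathcal{B}_\Gamma,\mathcal{B}_{\mathrm{T}}))=\mathsf{non}(\mathsf{U}_{[1,\aleph_0)}(\Gamma,\mathrm{T}))=\mathsf{non}(\mathsf{U}_{[1,\aleph_0)}(C_\Gamma,C_{\mathrm{T}}))=\mathfrak{b}.$$
   Context: A set of reals is an infinite, zero-dimensional, separable metrizable topological space $X$. A cover of $X$ is a family $\mathcal{U}$ of subsets of $X$ with $X\notin\mathcal{U}$ and $X=\bigcup\mathcal{U}$. A cover $\mathcal{U}$ of $X$ is: a large cover if for each $x\in X$ the set $\{U\in\mathcal{U}:x\in U\}$ is infinite; a $\tau$-cover if it is a large cover and for all $x,y\in X$ at least one of the sets $\{U\in\mathcal{U}:x\in U,\ y\notin U\}$, $\{U\in\mathcal{U}:y\in U,\ x\notin U\}$ is finite; a $\gamma$-cover if $\mathcal{U}$ is infinite and for each $x\in X$ the set $\{U\in\mathcal{U}:x\notin U\}$ is finite. $\mathrm{T},\Gamma$ denote the collections of all countable open $\tau$-covers and $\gamma$-covers of $X$, respectively; $C_{\mathrm{T}},C_\Gamma$ and $\mathcal{B}_{\mathrm{T}},\mathcal{B}_\Gamma$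 denote the corresponding collections of countable clopen covers and of countable Borel covers. For collections $\mathscr{A},\mathscr{B}$ of covers of $X$, $X$ satisfies $\mathsf{U}_{[1,\aleph_0)}(\mathscr{A},\mathscr{B})$ if for each sequence $\langle\mathcal{U}_n:n\in\mathbb{N}\rangle$ of members of $\mathscr{A}$ which do not contain finite subcovers, there exist finite nonempty subsets $\mathcal{F}_n\subseteq\mathcal{U}_n$, $n\in\mathbb{N}$, such that $\{\bigcup\mathcal{F}_n:n\in\mathbb{N}\}\in\mathscr{B}$. The critical cardinality $\mathsf{non}(P)$ of a property $P$ of sets of reals is the minimal cardinality of a set of reals not satisfying $P$. $\mathfrak{b}$ is the (un)bounding number: the minimal cardinality of a subset of $\mathbb{N}^{\mathbb{N}}$ that is unbounded with respect to eventual dominance $\le^*$. *)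

(* Defs.v *)
From HB Require Import structures.
From mathcomp Require Import all_boot all_order all_algebra.
From mathcomp Require Import all_classical all_reals all_analysis.

Set Implicit Arguments.
Unset Strict Implicit.
Unset Printing Implicit Defensive.

Import Order.TTheory GRing.Theory Num.Theory.
Local Open Scope classical_set_scope.
Local Open Scope ring_scope.

(** * Sets of reals *)

(* The last clause says that the given topology of [X] is the one of [d]. *)
Definition metrizable (R : realType) (X : topologicalType) : Prop :=
  exists d : X -> X -> R,
    [/\ forall x, d x x = 0,
        forall x y, d x y = 0 -> x = y,
        forall x y, d x y = d y x,
        forall y x z, d x z <= d x y + d y z
      & forall x, nbhs x =
          filter_from [set e | 0 < e] (fun e => [set y | d x y < e])].

Definition separable (X : topologicalType) : Prop :=
  exists2 D : set X, countable D & dense D.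

(* [zero_dimensional] of MathComp-Analysis only asks that clopen sets separate
   points, which for separable metrizable spaces is strictly weaker than having
   a base of clopen sets. *)
Definition set_of_reals (R : realType) (X : topologicalType) : Prop :=
  [/\ infinite_set [set: X], basis (@clopen X), separable X & metrizable R X].

(** * Covers *)

Section covers.
Context {X : Type}.
Implicit Types U : set (set X).

Definition is_cover U : Prop := ~ U setT /\ \bigcup_(A in U) A = setT.

Definition large_cover U : Prop :=
  is_cover U /\ forall x, infinite_set [set A | U A /\ A x].

Definition tau_cover U : Prop :=
  large_cover U /\
  forall x y, finite_set [set A | [/\ U A, A x & ~ A y]] \/
              finite_set [set A | [/\ U A, A y & ~ A x]].

Definition gamma_cover U : Prop :=
  [/\ is_cover U, infinite_set U &
      forall x, finite_set [set A | U A /\ ~ A x]].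

Definition has_finite_subcover U : Prop :=
  exists F : set (set X), [/\ F `<=` U, finite_set F & is_cover F].

Definition countable_covers (S : set (set X)) (K : set (set X) -> Prop) :
    set (set (set X)) :=
  [set U | [/\ countable U, U `<=` S & K U]].

(* The selection principle U_[1,aleph_0)(A, B). *)
Definition Ufin (A B : set (set (set X))) : Prop :=
  forall U : nat -> set (set X),
    (forall n, A (U n) /\ ~ has_finite_subcover (U n)) ->
    exists F : nat -> set (set X),
      (forall n, [/\ F n `<=` U n, finite_set (F n) & F n !=set0]) /\
      B (range (fun n => \bigcup_(V in F n) V)).

End covers.

Definition borel (X : topologicalType) : set (set X) := <<s @open X >>.

Definition open_Tau (X : topologicalType) :=
  countable_covers (@open X) tau_cover.
Definition open_Gamma (X : topologicalType) :=
  countable_covers (@open X) gamma_cover.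
Definition clopen_Tau (X : topologicalType) :=
  countable_covers (@clopen X) tau_cover.
Definition clopen_Gamma (X : topologicalType) :=
  countable_covers (@clopen X) gamma_cover.
Definition borel_Tau (X : topologicalType) :=
  countable_covers (@borel X) tau_cover.
Definition borel_Gamma (X : topologicalType) :=
  countable_covers (@borel X) gamma_cover.

(** * Cardinals *)

(* There is no type of cardinals: a cardinal is represented by any set [K]
   having that cardinality.  [is_min_card P A K] says that the minimum of
   the cardinals |A i|, over the [i] such that [P i], exists and is |K|; this
   determines [K] up to equipotence. *)
Definition is_min_card (I : Type) (P : I -> Prop) (T : I -> Type)
    (A : forall i, set (T i)) (W : Type) (K : set W) : Prop :=
  (exists i, P i /\ (A i #= K)%card) /\ (forall i, P i -> (K #<= A i)%card).

Definition is_non (R : realType) (P : topologicalType -> Prop)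
    (W : Type) (K : set W) : Prop :=
  is_min_card (fun X : topologicalType => set_of_reals R X /\ ~ P X)
    (fun X => [set: X]) K.

Definition le_star (f g : nat -> nat) : Prop :=
  \forall n \near \oo, (f n <= g n)%N.

Definition unbounded (B : set (nat -> nat)) : Prop :=
  ~ exists g, forall f, B f -> le_star f g.

Definition is_bounding_number (W : Type) (K : set W) : Prop :=
  is_min_card unbounded (fun B => B) K.

(* Main.v *)
From HB Require Import structures.
Require Import Defs.
From mathcomp Require Import all_boot all_order all_algebra.
From mathcomp Require Import all_classical all_reals all_analysis.

(** Let [K] be an unbounded set of functions of least cardinality; it exists
    because cardinals are well-ordered ([exists_min_card]).

    A space [X] with fewer than [K] points has the selection property, for any
    class of sets that is closed under finite unions ([Ufin_of_card_lt]).  Number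
    the members of each [U n] and let [f x n] be the number of a member of [U n]
    that contains [x].  The functions [f x] are too few to be unbounded; if [g]
    bounds them, the members of [U n] with number at most [g n] cover each point
    for all but finitely many [n].  Their unions form a gamma-cover, and a
    gamma-cover is a tau-cover.

    Conversely, one set of reals with [K] points defeats the three properties at
    once: its witness is a sequence of clopen gamma-covers none of whose
    selections is a tau-cover, whatever sets are allowed ([parity_not_Ufin]).
    The points are the pairs [(f, i)] of [K * nat], a set as large as [K]
    ([card_prod_nat]), with the topology of agreement on initial segments of the
    sequence [i, f 0, f 1, ...].  The [m]th member of the [n]th cover consists of
    the [(f, i)] with [i <= max n m] such that [i] has the parity of [n] or
    [f (n./2) <= m].  A selection from the [n]th cover lies in the [g n]th member
    for some [g].  Unboundedness of [K] gives [h0] and [h1] in [K] such that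
    [h0 (n./2) > g n] for infinitely many even [n] and [h1 (n./2) > g n] for
    infinitely many odd [n].  At those even [n] the selected union misses [(h0, 1)]
    and contains [(h1, 0)]; at those odd [n] it is the other way round.  The
    clause [i <= max n m] prevents the unions from repeating infinitely often, so
    both differences in the definition of a tau-cover are infinite. *)

Set Implicit Arguments.
Unset Strict Implicit.
Unset Printing Implicit Defensive.
Import Order.TTheory GRing.Theory Num.Theory.
Local Open Scope classical_set_scope.

(** * Cardinals *)

(** Zorn's lemma for the sets whose elements are pairwise related by [Q]: this
    property passes to unions of chains because it only involves two elements at
    a time. *)
Lemma exists_maximal_pairwise (T : Type) (Q : T -> T -> Prop) :
  exists S : set T, (forall s t, S s -> S t -> Q s t) /\
    (forall x, Q x x -> (forall s, S s -> Q x s /\ Q s x) -> S x).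
Proof.
have [|S [SQ Smax]] :=
    @Zorn_bigcup T [set S | forall s t, S s -> S t -> Q s t].
  move=> F FQ Ftot s t [A FA As] [B FB Bt].
  by have [AB|BA] := Ftot _ _ FA FB;
    [apply: (FQ B) => //; exact: AB | apply: (FQ A) => //; exact: BA].
exists S; split=> // x Qxx QxS; apply: contrapT => nSx.
apply: (Smax (S `|` [set x])).
  by split=> [y Sy|SS]; [left | apply/nSx/SS; right].
move=> s t [Ss|->] [St|->] //; first exact: SQ.
- by have [] := QxS s Ss.
- by have [] := QxS t St.
Qed.

Lemma card_le_injective (T U : Type) (A : set T) (B : set U) (f : T -> U) :
  {in A &, injective f} -> (forall a, A a -> B (f a)) -> (A #<= B)%card.
Proof.
move=> finj fAB; have := inj_card_eq finj.
rewrite card_eq_le => /andP[_ /card_le_trans]; apply.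
by apply: subset_card_le => _ [a /fAB ? <-].
Qed.

(** Cardinals are well-ordered.  Take a maximal set [S] of choice functions on [F]
    that pairwise differ everywhere on [F].  Some [A] in [F] is exhausted by the
    values of [S], for otherwise picking an unused value in each [B] would give a
    new function to put in [S].  Sending the value at [A] of a function of [S] to
    its value at [B] then embeds [A] into [B]. *)
Lemma exists_min_card (T : Type) (F : set (set T)) : F !=set0 ->
  exists2 A, F A & forall B, F B -> (A #<= B)%card.
Proof.
move=> [A0 FA0].
(* [a0] serves as the value of the choice functions off [F]. *)
have [[a0 _]|/set0P/negP/negPn/eqP A00] := pselect (A0 !=set0); last first.
  by exists A0 => // B _; rewrite A00; exact: card_ge0.
pose Q (s t : set T -> T) := forall B, F B -> B (s B) /\ (s B = t B -> s = t).
have [S [SQ Smax]] := exists_maximal_pairwise Q.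
have [A FA SA] : exists2 A, F A & forall a, A a -> exists2 s, S s & s A = a.
  apply: contrapT => noA.
  have /choice[x xP] (B : set T) : exists b,
      F B -> B b /\ forall s, S s -> s B <> b.
    have [FB|nFB] := pselect (F B); last by exists a0.
    apply: contrapT => nb; apply: noA; exists B => // b Bb.
    apply: contrapT => ns; apply: nb; exists b => _; split => // s Ss sBb.
    by apply: ns; exists s.
  have Sx : S x.
    apply: Smax => [B FB|s Ss]; first by have [] := xP B FB.
    split=> B FB; have [Bx nx] := xP B FB.
      by split=> // /esym /(nx _ Ss).
    by have [Bs _] := SQ s s Ss Ss B FB; split=> // /(nx _ Ss).
  by have [_ /(_ x Sx)] := xP A0 FA0.
exists A => // B FB.
have /choice[c cP] (a : T) : exists s : set T -> T, A a -> S s /\ s A = a.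
  by have [/SA[s Ss sa]|nAa] := pselect (A a); [exists s | exists (fun=> a)].
apply: (@card_le_injective _ _ _ _ (fun a => c a B)) => [a b|a].
  move=> /set_mem /cP[Sa ca] /set_mem /cP[Sb cb] cab.
  by rewrite -ca -cb; have [_ ->] := SQ _ _ Sa Sb B FB.
by move=> /cP[Sa _]; have [] := SQ _ _ Sa Sa B FB.
Qed.

(** A maximal disjoint family of injective sequences in [T] leaves only finitely
    many points out, so [T] is, up to a finite set, of the form [S * nat].  One
    sequence [s0] of the family absorbs the remainder, and [nat * nat] is
    countable. *)
Lemma card_prod_nat (T : Type) : infinite_set [set: T] ->
  ([set: (T * nat)%type] #= [set: T])%card.
Proof.
move=> Tinf.
(* For [s = t] this is injectivity, for [s <> t] disjointness of the ranges. *)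
pose Q (s t : nat -> T) := forall n m, s n = t m -> s = t /\ n = m.
have [S [SQ Smax]] := exists_maximal_pairwise Q.
pose rest := [set a | forall s n, S s -> s n <> a].
have rest_fin : finite_set rest.
  apply/finite_setPn; elim/Ppointed: T => T in Tinf Q S SQ Smax rest *.
    by case: Tinf; rewrite empty_eq0; exact: finite_set0.
  move=> /pcard_leP[e].
  have einj n m : e n = e m -> n = m by move=> /inj; apply; rewrite inE.
  have eR n : rest (e n) by exact: (@funS _ _ [set: nat] rest e n I).
  have Se : S e.
    by apply: Smax => [n m /einj //|s Ss]; split=> n m /esym;
      [move=> /(eR _ _ _ Ss) | move=> /esym /(eR _ _ _ Ss)].
  exact: (eR 0 e 0).
have [s0 Ss0] : S !=set0.
  apply: contrapT => S0; apply: Tinf; apply: sub_finite_set rest_fin.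
  by move=> a _ s n Ss; case: S0; exists s.
have /countable_injP[r rinj] := finite_set_countable rest_fin.
have /choice[phi phiP] (a : T) : exists p : (nat -> T) * (nat + nat),
    S p.1 /\ match p.2 with
             | inl n => p.1 n = a
             | inr k => [/\ rest a, p.1 = s0 & k = r a]
             end.
  have [ra|] := pselect (rest a); first by exists (s0, inr (r a)).
  move=> /existsNP[s /existsNP[n /not_implyP[Ss /contrapT sna]]].
  by exists (s, inl n).
have phi_inj : injective phi.
  move=> a b eab; have [_] := phiP a; have [_] := phiP b; rewrite -eab.
  case: (phi a).2 => [n eb ea|k [rb _ kb] [ra _ ka]]; first by rewrite -eb ea.
  by apply: rinj; [exact: mem_set | exact: mem_set | rewrite -ka].
apply/card_eqPle; split; last first.
  by apply: (@card_le_injective _ _ _ _ (fun a => (a, 0))) => // a b _ _ [].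
apply: (@card_le_injective _ _ _ _
  (fun am => (phi am.1).1 (pickle ((phi am.1).2, am.2)))) => // -[a m] [b k].
move=> _ _ /= /SQ[]; try by have [] := phiP a.
  by have [] := phiP b.
move=> e1 /(pcan_inj pickleK) [e2 ->]; congr pair; apply: phi_inj.
by rewrite (surjective_pairing (phi a)) e1 e2 -surjective_pairing.
Qed.

(** * Zero-dimensional spaces of codes in [nat -> nat] *)

Definition cylinder (T : Type) (c : T -> nat -> nat) (n : nat) (x : T) : set T :=
  [set y | forall k, (k < n)%N -> c y k = c x k].

Lemma cylinderS (T : Type) (c : T -> nat -> nat) n m x : (n <= m)%N ->
  cylinder c m x `<=` cylinder c n x.
Proof. by move=> nm y xy k kn; apply: xy; exact: leq_trans nm. Qed.

Lemma cylinder_eq (T : Type) (c : T -> nat -> nat) n x y : cylinder c n x y ->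
  cylinder c n y = cylinder c n x.
Proof. by move=> xy; apply/seteqP; split=> z yz k kn; rewrite yz // xy. Qed.

(** A copy of [T] that carries the topology induced through [c] by the product
    topology of [nat -> nat]. *)
Definition cylinder_space (T : Type) (c : T -> nat -> nat) : Type := T.

HB.instance Definition _ (T : Type) (c : T -> nat -> nat) :=
  gen_eqMixin (cylinder_space c).
HB.instance Definition _ (T : Type) (c : T -> nat -> nat) :=
  gen_choiceMixin (cylinder_space c).

Definition cylinder_nbhs (T : Type) (c : T -> nat -> nat)
    (x : cylinder_space c) : set_system (cylinder_space c) :=
  filter_from setT (fun n => cylinder c n x).

HB.instance Definition _ (T : Type) (c : T -> nat -> nat) :=
  hasNbhs.Build (cylinder_space c) (@cylinder_nbhs T c).

Lemma cylinder_nbhs_filter (T : Type) (c : T -> nat -> nat)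
  (x : cylinder_space c) : ProperFilter (nbhs x).
Proof.
apply: filter_from_proper; last by move=> n _; exists x.
apply: filter_from_filter; first by exists 0%N.
move=> n m _ _; exists (maxn n m) => // y xy.
by split; apply: cylinderS xy; [exact: leq_maxl | exact: leq_maxr].
Qed.

Lemma cylinder_nbhs_singleton (T : Type) (c : T -> nat -> nat)
  (x : cylinder_space c) (A : set (cylinder_space c)) : nbhs x A -> A x.
Proof. by move=> [n _]; apply. Qed.

Lemma cylinder_nbhs_nbhs (T : Type) (c : T -> nat -> nat)
  (x : cylinder_space c) (A : set (cylinder_space c)) :
  nbhs x A -> nbhs x (nbhs^~ A).
Proof.
move=> [n _ xA]; exists n => // y xy.
by exists n; rewrite ?(cylinder_eq xy).
Qed.

HB.instance Definition _ (T : Type) (c : T -> nat -> nat) :=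
  Nbhs_isNbhsTopological.Build (cylinder_space c) (@cylinder_nbhs_filter T c)
    (@cylinder_nbhs_singleton T c) (@cylinder_nbhs_nbhs T c).

(** The hypothesis says that the first [n] coordinates decide membership in [A];
    they then decide membership in its complement too. *)
Lemma cylinder_clopen (T : Type) (c : T -> nat -> nat) n
    (A : set (cylinder_space c)) :
  (forall x y, A x -> cylinder c n x y -> A y) -> clopen A.
Proof.
move=> An; rewrite /clopen -[A]setCK closedC setCK !openE.
split=> x Ax; exists n => // y xy; first exact: An xy.
by apply: contra_not Ax => /An; apply=> k kn; rewrite xy.
Qed.

Lemma cylinder_basis_clopen (T : Type) (c : T -> nat -> nat) :
  basis (@clopen (cylinder_space c)).
Proof.
split=> [A []//|x A [n _ xA]]; exists (cylinder c n x) => //; split=> //.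
by apply: (@cylinder_clopen _ _ n) => y z xy yz; rewrite -(cylinder_eq xy).
Qed.

(** There are countably many words [s]; choosing a point in each nonempty cylinder
    gives a countable dense set. *)
Lemma cylinder_separable (T : Type) (c : T -> nat -> nat) :
  separable (cylinder_space c).
Proof.
have [[x0 _]|T0] := pselect (exists x : T, True); last first.
  exists set0; first exact: countable0.
  by move=> O [x _]; case: T0; exists x.
have /choice[p pP] (s : seq nat) : exists x : T,
    (exists y, s = mkseq (c y) (size s)) -> s = mkseq (c x) (size s).
  have [[y sy]|ns] := pselect (exists y, s = mkseq (c y) (size s)).
    by exists y.
  by exists x0 => /ns.
exists (range p); first by apply: (sub_countable (card_image_le _ _)).
move=> O [x Ox]; rewrite openE => /(_ x Ox) [n _ nO].
have sn : size (mkseq (c x) n) = n by rewrite size_mkseq.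
exists (p (mkseq (c x) n)); split; last by exists (mkseq (c x) n).
apply: nO => k kn; have := pP (mkseq (c x) n); rewrite sn => /(_ _)/wrap[].
  by exists x.
by move=> /(congr1 (nth 0%N ^~ k)); rewrite !nth_mkseq // => ->.
Qed.

Section metric.
Local Open Scope ring_scope.

(** The distance is [1 / (k + 1)], where [k] is the first coordinate at which the
    two codes differ. *)
Definition cylinder_dist (R : realType) (T : Type) (c : T -> nat -> nat)
    (x y : T) : R :=
  if pselect (exists n, c x n != c y n) is left e
  then (ex_minn e).+1%:R^-1 else 0.

Lemma cylinder_dist_le (R : realType) (T : Type) (c : T -> nat -> nat) x y n :
  cylinder_dist R c x y <= n.+1%:R^-1 <-> cylinder c n x y.
Proof.
rewrite /cylinder_dist; case: pselect => [e|ne].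
  case: ex_minnP => m cm mmin; rewrite lef_pV2 ?posrE ?ltr0n // ler_nat ltnS.
  split=> [nm k kn|xy].
    apply/eqP; apply: contraT => /eqP ck; have := mmin k.
    by rewrite leqNgt (leq_trans kn nm) /= => -> //; apply/eqP => ckk; apply: ck.
  by rewrite leqNgt; apply: contra cm => /xy ->.
split=> [_ k _|_]; last by rewrite invr_ge0 ler0n.
by apply/eqP; apply: contraT => ck; case: ne; exists k; rewrite eq_sym.
Qed.

Lemma cylinder_dist_ge0 (R : realType) (T : Type) (c : T -> nat -> nat) x y :
  0 <= cylinder_dist R c x y.
Proof.
by rewrite /cylinder_dist; case: pselect => // e; rewrite invr_ge0 ler0n.
Qed.

Lemma cylinder_dist_ge (R : realType) (T : Type) (c : T -> nat -> nat) x y n :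
  c x n != c y n -> n.+1%:R^-1 <= cylinder_dist R c x y.
Proof.
move=> xyn; rewrite /cylinder_dist; case: pselect => [e|[]]; last by exists n.
case: ex_minnP => m _ mmin.
by rewrite lef_pV2 ?posrE ?ltr0n // ler_nat ltnS mmin.
Qed.

Lemma cylinder_metrizable (R : realType) (T : Type) (c : T -> nat -> nat) :
  injective c -> metrizable R (cylinder_space c).
Proof.
move=> c_inj; pose d := @cylinder_dist R T c; exists d.
have dsym x y : d x y = d y x.
  rewrite /d /cylinder_dist; case: pselect => [e|ne]; case: pselect => [e'|ne'].
  - by congr (_.+1%:R^-1); apply: eq_ex_minn => n; rewrite eq_sym.
  - by case: e => n cn; case: ne'; exists n; rewrite eq_sym.
  - by case: e' => n cn; case: ne; exists n; rewrite eq_sym.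
  - by [].
have d0 x y : d x y = 0 -> x = y.
  move=> xy0; apply/c_inj/funext => k.
  have /cylinder_dist_le : d x y <= k.+2%:R^-1 by rewrite xy0 invr_ge0 ler0n.
  by move=> /(_ k) ->.
split=> //.
- move=> x; rewrite /d /cylinder_dist; case: pselect => // e.
  by exfalso; case: e => n; rewrite eqxx.
- move=> y x z; rewrite {1}/d /cylinder_dist; case: pselect => [e|_]; last first.
    by rewrite addr_ge0 ?cylinder_dist_ge0.
  (* The first coordinate separating [x] from [z] separates [y] from one of them. *)
  case: ex_minnP => m xzm _; have [xym|xym] := eqVneq (c x m) (c y m).
    by rewrite ler_wpDl ?cylinder_dist_ge0 ?cylinder_dist_ge // -xym.
  by rewrite ler_wpDr ?cylinder_dist_ge0 ?cylinder_dist_ge.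
- move=> x; apply/seteqP; split=> A [].
    move=> n _ nA; exists n.+1%:R^-1 => /=; first by rewrite invr_gt0 ltr0n.
    by move=> y /ltW /cylinder_dist_le; exact: nA.
  move=> e /= e0 eA.
  have [n _ /(_ n (leqnn n))/= ne] := near_infty_natSinv_lt (PosNum e0).
  exists n => // y /(cylinder_dist_le R) xy; apply: eA.
  exact: le_lt_trans xy ne.
Qed.
End metric.

(** * Small spaces have the selection property *)

Lemma finite_near_compl (A : set nat) :
  (\forall n \near \oo, A n) -> finite_set (~` A).
Proof.
move=> [N _ NA]; apply: sub_finite_set (finite_II N) => n nA /=.
by rewrite ltnNge; apply/negP => /NA.
Qed.

Lemma infinite_image (T : Type) (I : set nat) (A : nat -> T) :
  infinite_set I ->
  (forall n, I n -> finite_set [set k | I k /\ A k = A n]) ->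
  infinite_set (A @` I).
Proof.
move=> Iinf fib; apply: contra_not Iinf => AIfin.
apply: (@sub_finite_set _ _ (\bigcup_(B in A @` I) [set k | I k /\ A k = B])).
  by move=> n In; exists (A n) => //; exists n.
by apply: bigcup_finite => // _ [n In <-]; exact: fib.
Qed.

Lemma gamma_cover_tau (X : Type) (U : set (set X)) :
  gamma_cover U -> tau_cover U.
Proof.
move=> [Ucov Uinf Ux]; split.
  split=> // x; apply: contra_not Uinf => xfin.
  rewrite (_ : U = [set A | U A /\ A x] `|` [set A | U A /\ ~ A x]).
    by rewrite finite_setU.
  by apply/seteqP; split=> [A UA|A [[]|[]]//]; case: (pselect (A x)); [left|right].
by move=> x y; left; apply: sub_finite_set (Ux y) => A [].
Qed.

(** The range is infinite because no set is taken infinitely often: each [A n]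
    misses some [y], which belongs to almost all [A k]. *)
Lemma gamma_cover_range (X : Type) (A : nat -> set X) (x0 : X) :
  (forall n, A n <> setT) -> (forall x, \forall n \near \oo, A n x) ->
  gamma_cover (range A).
Proof.
move=> AT Ax; split.
- split; first by move=> [n _ /AT].
  apply/seteqP; split=> // x _; have [N _ /(_ N (leqnn N)) AN] := Ax x.
  by exists (A N) => //; exists N.
- apply: infinite_image; first exact: infinite_nat.
  move=> n _; have /existsNP[y nAy] : ~ forall y, A n y.
    by move=> An; apply: (AT n); apply/seteqP; split=> // y _; exact: An.
  apply: sub_finite_set (finite_near_compl (Ax y)) => k [_ /= ->].
  by [].
- move=> x; apply: sub_finite_set (finite_image A (finite_near_compl (Ax x))).
  by move=> _ [[n _ <-] nAx]; exists n.
Qed.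

Lemma has_finite_subcover_bigcup (X : Type) (U F : set (set X)) :
  is_cover U -> ~ has_finite_subcover U -> F `<=` U -> finite_set F ->
  \bigcup_(V in F) V <> setT.
Proof.
move=> [nUT _] nfin FU Ffin FT; apply: nfin; exists F; split=> //.
by split=> // /FU.
Qed.

(** Each point [x] yields the function [f x] whose value at [n] is the number of
    a member of [U n] containing [x].  These functions form a set onto which [X]
    maps, hence one of fewer than [K] elements, and a bound for it tells how far
    to go in each cover. *)
Lemma Ufin_of_card_lt (X W : Type) (K : set W) (S : set (set X)) (x0 : X) :
  (forall B, unbounded B -> (K #<= B)%card) -> ~ (K #<= [set: X])%card ->
  fin_bigcup_closed S ->
  Ufin (countable_covers S gamma_cover) (countable_covers S tau_cover).
Proof.
move=> Kmin KX Sfin U Uok.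
have Ucnt n : countable (U n) by have [[]] := Uok n.
have US n : U n `<=` S by have [[]] := Uok n.
have Ucov n : is_cover (U n) by have [[_ _ []]] := Uok n.
have nfin n : ~ has_finite_subcover (U n) by have [] := Uok n.
have /choice[code codeP] n : exists f : set X -> nat, {in U n &, injective f}.
  exact/countable_injP.
have /choice[V VP] (xn : X * nat) : exists A, U xn.2 A /\ A xn.1.
  have [_ UT] := Ucov xn.2; have [A UA Ax] : (\bigcup_(A in U xn.2) A) xn.1.
    by rewrite UT.
  by exists A.
pose f x n := code n (V (x, n)).
have [g gP] : exists g, forall x, le_star (f x) g.
  apply: contrapT => nog; apply: KX; apply: card_le_trans (card_image_le f setT).
  by apply: Kmin => -[g gP]; apply: nog; exists g => x; apply: gP; exists x.
(* The maximum puts the member [V (x0, n)] in [F n], which must be nonempty. *)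
pose F n := [set A | U n A /\
  (code n A <= maxn (g n) (code n (V (x0, n))))%N].
have FU n : F n `<=` U n by move=> A [].
have Ffin n : finite_set (F n).
  apply/(card_le_finite _ (finite_II (maxn (g n) (code n (V (x0, n)))).+1)).
  apply: (@card_le_injective _ _ _ _ (code n)) => [A B|A []//].
  by move=> /set_mem[UA _] /set_mem[UB _]; apply: codeP; exact: mem_set.
have F0 n : F n !=set0.
  exists (V (x0, n)); split; last exact: leq_maxr.
  by have [] := VP (x0, n).
exists F; split=> [n //|]; split.
- by apply: (sub_countable (card_image_le _ _)).
- by move=> _ [n _ <-]; apply: Sfin => // A /FU /US.
- apply/gamma_cover_tau/(gamma_cover_range x0) => [n|x].
    exact: has_finite_subcover_bigcup.
  have := gP x; rewrite /le_star; apply: filterS => n fg.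
  have [Un Vx] := VP (x, n); exists (V (x, n)) => //.
  by split=> //; rewrite leq_max fg.
Qed.

(** * Unbounded sets of functions *)

Lemma unboundedP (K : set (nat -> nat)) (g : nat -> nat) : unbounded K ->
  exists2 f, K f & infinite_set [set n | (g n < f n)%N].
Proof.
move=> Kunb; apply: contrapT => nof; apply: Kunb; exists g => f Kf.
apply: contrapT => nfg; apply: nof; exists f => // fin; apply: nfg.
have /finite_seqP[s sE] := fin.
exists (\max_(n <- s) n).+1 => // n /= sn.
rewrite leqNgt; apply/negP => gfn.
have : [set n | (g n < f n)%N] n by [].
rewrite sE => /= ns; move: sn; rewrite ltnNge => /negP; apply.
exact: leq_bigmax_seq.
Qed.

Lemma unbounded_infinite (K : set (nat -> nat)) : unbounded K -> infinite_set K.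
Proof.
move=> Kunb Kfin; apply: Kunb; have /finite_seqP[s sE] := Kfin.
exists (fun n => \max_(f <- s) f n)%N => f; rewrite sE /= => fs.
by exists 0%N => // n _; exact: (leq_bigmax_seq (F := fun f : nat -> nat => f n)).
Qed.


(** * A space without the selection property *)

Definition parity_code (T : Type) (v : T -> nat -> nat) (x : T * nat)
    (n : nat) : nat :=
  if n is k.+1 then v x.1 k else x.2.

Lemma parity_code_inj (T : Type) (v : T -> nat -> nat) :
  injective v -> injective (parity_code v).
Proof.
move=> vinj [s i] [t j] /funeqP e.
congr pair; last exact: (e 0%N).
by apply/vinj/funext => k; exact: (e k.+1).
Qed.

(** The [m]th member of the [n]th cover.  Points whose second component has the
    wrong parity enter only when [m] reaches a value of their function, which is
    how an unbounded family escapes every selection; the index is [n./2] so that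
    each function can be used along the even as well as along the odd [n]. *)
Definition parity_set (T : Type) (v : T -> nat -> nat) (n m : nat) :
    set (T * nat) :=
  [set x | (x.2 <= maxn n m)%N /\ (odd x.2 = odd n \/ (v x.1 n./2 <= m)%N)].

Lemma parity_setS (T : Type) (v : T -> nat -> nat) n m m' : (m <= m')%N ->
  parity_set v n m `<=` parity_set v n m'.
Proof.
move=> mm' x [x2 xn]; split.
  by apply: leq_trans x2 _; rewrite geq_max leq_maxl leq_max mm' orbT.
by case: xn => [|/leq_trans]; [left | right; auto].
Qed.

Lemma parity_set_neqT (T : Type) (v : T -> nat -> nat) (t : T) n m :
  parity_set v n m <> setT.
Proof.
move=> /seteqP[_ /(_ (t, (maxn n m).+1) I) []] /=.
by rewrite ltnn.
Qed.

Lemma parity_set_gamma (T : Type) (v : T -> nat -> nat) (t : T) n :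
  gamma_cover (range (parity_set v n)).
Proof.
apply: (gamma_cover_range (t, 0%N)) => [m|x]; first exact: parity_set_neqT.
exists (maxn x.2 (v x.1 n./2)) => // m /=; rewrite geq_max => /andP[xm vm].
by split; [rewrite leq_max xm orbT | right].
Qed.

(** The [n]th cover is increasing, so a finite selection is no better than a single
    member. *)
Lemma parity_set_bounded (T : Type) (v : T -> nat -> nat) n F :
  F `<=` range (parity_set v n) -> finite_set F ->
  exists m, \bigcup_(V in F) V `<=` parity_set v n m.
Proof.
move=> FU Ffin.
have /choice[r rP] A : exists m, F A -> A = parity_set v n m.
  by have [/FU[m _ <-]|nF] := pselect (F A); [exists m | exists 0%N].
have /finite_seqP[s sE] := finite_image r Ffin.
exists (\max_(m <- s) m) => x [A FA]; rewrite (rP _ FA); apply: parity_setS.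
have : (r @` F) (r A) by exists A.
rewrite sE => rs; exact: leq_bigmax_seq.
Qed.

Lemma parity_set_clopen (T : Type) (v : T -> nat -> nat) n m :
  @clopen (cylinder_space (parity_code v)) (parity_set v n m).
Proof.
apply: (@cylinder_clopen _ _ n./2.+2) => x y [x2 xn] xy.
have y2 : y.2 = x.2 := xy 0%N isT.
have y1 : v y.1 n./2 = v x.1 n./2 := xy n./2.+1 (ltnSn _).
by split; rewrite y2 ?y1.
Qed.

(** For a parity [b], the point [z b] has second component of the other parity and
    a function [h b] that exceeds [g] infinitely often along the indices of parity
    [b].  At these indices the union of the selection misses [z b], while it
    contains [z (~~ b)] because a selection is nonempty.  Taking both values of
    [b], each of the two points is infinitely often separated from the other. *)
Lemma parity_not_tau (T : Type) (v : T -> nat -> nat)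
    (F : nat -> set (set (T * nat))) :
  (forall g, exists t, infinite_set [set n | (g n < v t n)%N]) ->
  (forall n, [/\ F n `<=` range (parity_set v n), finite_set (F n) & F n !=set0]) ->
  ~ tau_cover (range (fun n => \bigcup_(V in F n) V)).
Proof.
move=> vunb FP; set A := fun n => _ => -[_ Atau].
have /choice[g gP] n : exists m, A n `<=` parity_set v n m.
  by have [FU Ffin _] := FP n; exact: parity_set_bounded.
have /choice[h hP] (b : bool) :
  exists t, infinite_set [set k | (g (b + k.*2) < v t k)%N] := vunb _.
have Aparity n x : (x.2 <= n)%N -> odd x.2 = odd n -> A n x.
  move=> xn xodd; have [FU _ [V FV]] := FP n; exists V => //.
  have [m _ <-] := FU _ FV.
  by split; [rewrite leq_max xn | left].
pose z b := (h b, nat_of_bool (~~ b)).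
have zinf b :
    infinite_set [set B | [/\ range A B, B (z (~~ b)) & ~ B (z b)]].
  pose I := [set n | odd n = b /\ (g n < v (h b) n./2)%N].
  have Iinf : infinite_set I.
    apply: contra_not (hP b) => /(finite_image half); apply: sub_finite_set.
    move=> k /= gk; exists (b + k.*2)%N; last exact: half_bit_double.
    by split; rewrite ?half_bit_double// oddD odd_double addbF oddb.
  apply: sub_infinite_set (@infinite_image _ _ A Iinf _); last first.
    (* The point [(h b, i)] is beyond the reach of [A n], but it belongs to [A k]
       for every [k >= i] of parity [b]; hence [A n] is repeated finitely often. *)
    move=> n _; pose i := (b + (maxn n (g n)).+1.*2)%N.
    apply: sub_finite_set (finite_II i) => k [[kb _] Akn] /=.
    rewrite ltnNge; apply/negP => ik.
    have : A k (h b, i) by apply: Aparity; rewrite //= oddD odd_double addbF oddb.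
    rewrite Akn => /gP[/= + _]; rewrite leqNgt => /negP; apply.
    by rewrite /i ltn_addl // -addnn ltn_addr.
  move=> _ [n [nb gn] <-]; split; first by exists n.
    apply: Aparity; rewrite /= negbK -nb ?oddb //.
    by case: (n) => // k; exact: leq_trans (leq_b1 _) _.
  move=> /gP[_ /=]; rewrite oddb nb => -[|]; first by case: (b).
  by rewrite leqNgt gn.
have [] := Atau (z true) (z false); first exact: (zinf false).
exact: (zinf true).
Qed.

Lemma parity_not_Ufin (T : Type) (v : T -> nat -> nat) (S : set (set (T * nat))) :
  (forall g, exists t, infinite_set [set n | (g n < v t n)%N]) ->
  @clopen (cylinder_space (parity_code v)) `<=` S ->
  ~ Ufin (countable_covers S gamma_cover) (countable_covers S tau_cover).
Proof.
move=> vunb clS; have [t _] := vunb id.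
have Ugamma := parity_set_gamma v t.
move=> /(_ (fun n => range (parity_set v n)))[n|F [FP [_ _]]].
  split.
    split=> //; first by apply: (sub_countable (card_image_le _ _)).
    by move=> _ [m _ <-]; apply/clS/parity_set_clopen.
  move=> [F [FU Ffin [_ FT]]]; have [m Fm] := parity_set_bounded FU Ffin.
  apply: (@parity_set_neqT _ v t n m); apply/seteqP; split=> // x _.
  by apply: Fm; rewrite FT.
exact: parity_not_tau.
Qed.

(** * Critical cardinalities *)

Lemma open_fin_bigcup (X : topologicalType) : fin_bigcup_closed (@open X).
Proof. by apply/fin_bigcup_closedP; split; [exact: open0 | exact: openU]. Qed.

Lemma clopen_fin_bigcup (X : topologicalType) : fin_bigcup_closed (@clopen X).
Proof. by apply/fin_bigcup_closedP; split; [exact: clopen0 | exact: clopenU]. Qed.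

Lemma borel_fin_bigcup (X : topologicalType) : fin_bigcup_closed (@borel X).
Proof.
apply/fin_bigcup_closedP; split; first exact: sigma_algebra0.
move=> A B bA bB; rewrite -bigcup2E; apply: sigma_algebra_bigcup.
by move=> [|[|n]] //=; exact: sigma_algebra0.
Qed.

(** Common form of the three equalities: closure of [S X] under finite unions gives
    the lower bound for the cardinality of a counterexample, and the presence of
    the clopen sets makes the space on [K * nat] one. *)
Lemma non_Ufin (R : realType) (K : set (nat -> nat))
    (S : forall X : topologicalType, set (set X)) :
  unbounded K -> (forall B, unbounded B -> (K #<= B)%card) ->
  (forall X, fin_bigcup_closed (S X)) -> (forall X, @clopen X `<=` S X) ->
  is_non R (fun X => Ufin (countable_covers (S X) gamma_cover)
                          (countable_covers (S X) tau_cover)) K.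
Proof.
move=> Kunb Kmin Sfin clS; split; last first.
  move=> X [[Xinf _ _ _] nU]; apply: contrapT => KX; apply: nU.
  have [x0 _] := infinite_setN0 Xinf.
  exact: Ufin_of_card_lt Kmin KX (Sfin X).
pose v (t : K) := set_val t.
have KX : ([set: K * nat] #= K)%card.
  apply: card_eq_trans (card_setT K); apply: card_prod_nat.
  by rewrite (eq_finite_set (card_setT K)); exact: unbounded_infinite.
exists (cylinder_space (parity_code v)); split=> //; split; last first.
  apply: parity_not_Ufin (clS _) => g.
  have [f /mem_set fK finf] := unboundedP g Kunb.
  by exists (exist _ f fK).
split.
- by rewrite (eq_finite_set KX); exact: unbounded_infinite.
- exact: cylinder_basis_clopen.
- exact: cylinder_separable.
- by apply/cylinder_metrizable/parity_code_inj; exact: val_inj.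
Qed.

Theorem corollary2p6 (R : realType) :
  exists K : set (nat -> nat),
    [/\ is_non R (fun X => Ufin (@borel_Gamma X) (@borel_Tau X)) K,
        is_non R (fun X => Ufin (@open_Gamma X) (@open_Tau X)) K,
        is_non R (fun X => Ufin (@clopen_Gamma X) (@clopen_Tau X)) K
      & is_bounding_number K].
Proof.
have [|K Kunb Kmin] := @exists_min_card _ unbounded.
  exists setT => -[g /(_ (fun n => (g n).+1) I)] [N _ /(_ N (leqnn N))] /=.
  by rewrite ltnn.
exists K; split.
- apply: (non_Ufin R (S := borel)) => // X; first exact: borel_fin_bigcup.
  by move=> A [Aop _]; exact: sub_sigma_algebra.
- apply: (non_Ufin R (S := @open)) => // X; first exact: open_fin_bigcup.
  by move=> A [].
- apply: (non_Ufin R (S := @clopen)) => // X; first exact: clopen_fin_bigcup.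
  by [].
- by split=> //; exists K.
Qed.
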